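(* Let $G=\{\alpha_t : t\in\mathbb{N}\}$ be a countable subgroup of $\mathbb{T}=\mathbb{R}/\mathbb{Z}$. Then there exists a set $A\subseteq\mathbb{N}$ (regarded as an increasing sequence of positive integers) such that for all $\beta\in\mathbb{T}$: $$\beta\in G \;\Rightarrow\; \text{for every } r>0:\ \sum_{n\in A}\|n\beta\|^r<\infty,\qquad\qquad \beta\notin G\;\Rightarrow\;\limsup_{n\in A,\,n\to\infty}\|n\beta\|\ge 1/6.$$
   Context: $\mathbb{T}=\mathbb{R}/\mathbb{Z}$, and for $x\in\mathbb{T}$ (or $x\in\mathbb{R}$), $\|x\|$ denotes the distance from $x$ to the nearest integer. *)

(* Defs.v *)
From Stdlib Require Import Reals.
From Coquelicot Require Import Coquelicot.
Open Scope R_scope.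

Definition dist_Z (x : R) : R := Rmin (frac_part x) (1 - frac_part x).

(* Real power x^r for x >= 0, r > 0, with the convention 0^r = 0
   (Stdlib's Rpower 0 r would be 1, so we guard it). *)
Definition rpow (x r : R) : R := if Req_EM_T x 0 then 0 else Rpower x r.

(* Membership in the subgroup G = {alpha_t mod 1 : t in nat} of T = R/Z,
   for a representative x in R. *)
Definition inG (alpha : nat -> R) (x : R) : Prop :=
  exists (t : nat) (z : Z), x = alpha t + IZR z.

Definition is_subgroup_T (alpha : nat -> R) : Prop :=
  inG alpha 0 /\ (forall x y, inG alpha x -> inG alpha y -> inG alpha (x - y)).

(* Main.v *)
Require Import Defs.
From Stdlib Require Import Reals.
From Coquelicot Require Import Coquelicot.
From Stdlib Require FinFun.
From Stdlib Require Import Lra Lia ZArith Arith List Wf_nat Classical ClassicalEpsilon.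
Import ListNotations.
Open Scope R_scope.

(* For a finite [F] in [G] consider the Bohr sets [bohr F e] of the [n] with [||n f|| <= e] on
   [F].  At the scales [4^-k] each Bohr set, cut to [[0, N]], is covered by a bounded number of
   translates of the next one.  Taking the doublings [2^j x], [j <= k], of the translations [x]
   at scale [4^-k] (each shifted by a large [w] in a Bohr set) gives a finite set [A] on which
   [sum ||n f||^r] is a tail of a convergent series whatever [N] is, and such that
   [||n beta|| < 1/6] on [A] forces [||n beta|| <= 1/12] on the whole Bohr set up to [N].

   By a Fourier argument this puts [beta] near a finite subset [D] of [G], which is added to
   [F] for the next stage.  If [beta = d + gamma] survives all stages from some point on, then
   the Bohr sets of the later stages, being syndetic, contain enough [n] with [||n gamma||]
   small to shrink [gamma] at each stage; so [gamma = 0] and [beta] is in [G]. *)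

(** * Bohr sets *)

(** Equivalent to [dist_Z x <= e], but with an explicit integer, so that sums, differences and
    multiples are handled by combining witnesses instead of by cases on fractional parts. *)
Definition near (e x : R) : Prop := exists z : Z, Rabs (x - IZR z) <= e.

Lemma near_weaken (e e' x : R) : e <= e' -> near e x -> near e' x.
Proof. intros H [z Hz]; exists z; lra. Qed.

Lemma near_add (e e' x y : R) : near e x -> near e' y -> near (e + e') (x + y).
Proof.
  intros [z Hz] [z' Hz']; exists (z + z')%Z; rewrite plus_IZR.
  replace (x + y - (IZR z + IZR z')) with ((x - IZR z) + (y - IZR z')) by ring.
  eapply Rle_trans; [apply Rabs_triang | lra].
Qed.

Lemma near_opp (e x : R) : near e x -> near e (- x).
Proof.
  intros [z Hz]; exists (- z)%Z; rewrite opp_IZR.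
  replace (- x - - IZR z) with (- (x - IZR z)) by ring; now rewrite Rabs_Ropp.
Qed.

Lemma near_sub (e e' x y : R) : near e x -> near e' y -> near (e + e') (x - y).
Proof. intros; apply near_add; [ | apply near_opp]; assumption. Qed.

Lemma near_mult_Z (e x : R) (m : Z) : (0 <= m)%Z -> near e x -> near (IZR m * e) (IZR m * x).
Proof.
  intros Hm [z Hz]; exists (m * z)%Z; rewrite mult_IZR, <- Rmult_minus_distr_l, Rabs_mult.
  assert (0 <= IZR m) by now apply IZR_le.
  rewrite (Rabs_right (IZR m)) by lra; now apply Rmult_le_compat_l.
Qed.

Lemma near_half (x : R) : near (1 / 2) x.
Proof.
  destruct (base_fp x) as [H1 H2]; unfold frac_part in H1, H2.
  destruct (Rle_dec (x - IZR (Int_part x)) (1 / 2)).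
  - exists (Int_part x); apply Rabs_le; lra.
  - exists (Int_part x + 1)%Z; rewrite plus_IZR; apply Rabs_le; lra.
Qed.

Lemma near_small (e x : R) : e < 1 / 2 -> Rabs x < 1 / 2 -> near e x -> Rabs x <= e.
Proof.
  intros He Hx [z Hz].
  assert (Hz0 : z = 0%Z).
  { apply Rabs_def2 in Hx; apply Rabs_le_between in Hz.
    assert (-1 < IZR z < 1) as [H1 H2] by lra.
    apply lt_IZR in H1; apply lt_IZR in H2; lia. }
  subst z; now rewrite Rminus_0_r in Hz.
Qed.

Lemma dist_Z_ge0 (x : R) : 0 <= dist_Z x.
Proof. destruct (base_fp x); unfold dist_Z; apply Rmin_glb; lra. Qed.

Lemma near_dist_Z (x : R) : near (dist_Z x) x.
Proof.
  destruct (base_fp x) as [H1 H2]; unfold dist_Z.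
  unfold frac_part in *; apply Rmin_case.
  - exists (Int_part x); rewrite Rabs_right; lra.
  - exists (Int_part x + 1)%Z; rewrite plus_IZR, Rabs_left1; lra.
Qed.

Lemma dist_Z_le_near (e x : R) : near e x -> dist_Z x <= e.
Proof.
  intros [z Hz]; destruct (base_fp x) as [H1 H2]; unfold dist_Z.
  unfold frac_part in *; apply Rabs_le_between in Hz.
  destruct (Z_le_gt_dec z (Int_part x)) as [H | H].
  - apply IZR_le in H; eapply Rle_trans; [apply Rmin_l | lra].
  - assert (H' : (Int_part x + 1 <= z)%Z) by lia.
    apply IZR_le in H'; rewrite plus_IZR in H'.
    eapply Rle_trans; [apply Rmin_r | lra].
Qed.

Definition bohr (F : list R) (e : R) (n : Z) : Prop :=
  forall f, In f F -> near e (IZR n * f).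

Lemma bohr_weaken (F : list R) (e e' : R) (n : Z) : e <= e' -> bohr F e n -> bohr F e' n.
Proof. intros H Hb f Hf; apply (near_weaken e); auto. Qed.

Lemma bohr_add (F : list R) (e e' : R) (m n : Z) :
  bohr F e m -> bohr F e' n -> bohr F (e + e') (m + n).
Proof.
  intros Hm Hn f Hf; rewrite plus_IZR, Rmult_plus_distr_r; apply near_add; auto.
Qed.

Lemma bohr_opp (F : list R) (e : R) (n : Z) : bohr F e n -> bohr F e (- n).
Proof.
  intros Hn f Hf; rewrite opp_IZR, Ropp_mult_distr_l_reverse; apply near_opp; auto.
Qed.

Lemma bohr_mult (F : list R) (e : R) (m n : Z) :
  (0 <= m)%Z -> bohr F e n -> bohr F (IZR m * e) (m * n).
Proof.
  intros Hm Hn f Hf; rewrite mult_IZR, Rmult_assoc; apply near_mult_Z; auto.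
Qed.

(** Pigeonhole, one frequency at a time: [[-e, e]] splits into eight cells of length [e / 4], and
    two points in the same cell differ by at most [e / 4]. The bound on the net depends neither on
    [e] nor on [P], which may be a Bohr set cut to an interval of any length. *)
Lemma bohr_net (F : list R) (e : R) (P : Z -> Prop) :
  0 < e -> (forall n, P n -> bohr F e n) ->
  exists X : list Z, (length X <= 8 ^ length F)%nat /\ (forall x, In x X -> P x) /\
    forall n, P n -> exists x, In x X /\ bohr F (e / 4) (n - x).
Proof.
  intros He; revert P; induction F as [ | f F IH]; intros P HP.
  - destruct (classic (exists n, P n)) as [[n0 Hn0] | Hno].
    + exists [n0]; split; [simpl; lia | split].
      * intros x [<- | []]; exact Hn0.
      * intros n _; exists n0; split; [now left | intros f []].
    + exists []; split; [simpl; lia | split].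
      * intros x [].
      * intros n Hn; exfalso; apply Hno; now exists n.
  - set (cell := fun (j : nat) (n : Z) => exists z : Z,
      - e + INR j * (e / 4) <= IZR n * f - IZR z <= - e + (INR j + 1) * (e / 4)).
    assert (Hcells : forall J : nat, exists X : list Z,
      (length X <= J * 8 ^ length F)%nat /\ (forall x, In x X -> P x) /\
      forall n j, (j < J)%nat -> P n -> cell j n ->
        exists x, In x X /\ bohr (f :: F) (e / 4) (n - x)).
    { induction J as [ | J [X (HX1 & HX2 & HX3)]].
      - exists []; split; [simpl; lia | split; [intros x [] | intros; lia]].
      (* [P] is restricted to one cell before the induction hypothesis is used, so each
         representative shares the cell of the points it represents. *)
      - destruct (IH (fun n => P n /\ cell J n)) as [Y (HY1 & HY2 & HY3)].
        { intros n [Hn _] g Hg; apply HP; [exact Hn | now right]. }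
        exists (X ++ Y); split; [rewrite length_app; simpl; lia | split].
        + intros x Hx; apply in_app_or in Hx; destruct Hx as [Hx | Hx]; [auto | ].
          now apply HY2.
        + intros n j Hj Hn Hc.
          destruct (Nat.eq_dec j J) as [-> | Hne].
          * destruct (HY3 n (conj Hn Hc)) as [x [Hx Hb]].
            exists x; split; [apply in_or_app; now right | ].
            intros g [<- | Hg]; [ | now apply Hb].
            destruct (HY2 x Hx) as [_ [z Hz]]; destruct Hc as [z' Hz'].
            exists (z' - z)%Z; rewrite !minus_IZR; apply Rabs_le; lra.
          * destruct (HX3 n j ltac:(lia) Hn Hc) as [x [Hx Hb]].
            exists x; split; [apply in_or_app; now left | exact Hb]. }
    destruct (Hcells 8%nat) as [X (HX1 & HX2 & HX3)].
    exists X; split; [exact HX1 | split; [exact HX2 | ]].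
    intros n Hn.
    assert (Hc : exists j, (j < 8)%nat /\ cell j n).
    { destruct (HP n Hn f (or_introl eq_refl)) as [z Hz].
      apply Rabs_le_between in Hz.
      set (v := IZR n * f - IZR z) in *.
      assert (Hcell : forall j : nat,
        - e + INR j * (e / 4) <= v <= - e + (INR j + 1) * (e / 4) -> cell j n)
        by (intros j Hj; exists z; exact Hj).
      destruct (Rle_dec v (- e + e / 4));
        [exists 0%nat; split; [lia | apply Hcell; simpl; lra] | ].
      destruct (Rle_dec v (- e + 2 * (e / 4)));
        [exists 1%nat; split; [lia | apply Hcell; simpl; lra] | ].
      destruct (Rle_dec v (- e + 3 * (e / 4)));
        [exists 2%nat; split; [lia | apply Hcell; simpl; lra] | ].
      destruct (Rle_dec v (- e + 4 * (e / 4)));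
        [exists 3%nat; split; [lia | apply Hcell; simpl; lra] | ].
      destruct (Rle_dec v (- e + 5 * (e / 4)));
        [exists 4%nat; split; [lia | apply Hcell; simpl; lra] | ].
      destruct (Rle_dec v (- e + 6 * (e / 4)));
        [exists 5%nat; split; [lia | apply Hcell; simpl; lra] | ].
      destruct (Rle_dec v (- e + 7 * (e / 4)));
        [exists 6%nat; split; [lia | apply Hcell; simpl; lra] | ].
      exists 7%nat; split; [lia | apply Hcell; simpl; lra]. }
    destruct Hc as [j [Hj Hc]]; exact (HX3 n j Hj Hn Hc).
Qed.

Lemma list_Z_bounded (X : list Z) : exists B : Z, forall x, In x X -> (- B <= x <= B)%Z.
Proof.
  induction X as [ | x X [B HB]].
  - exists 0%Z; intros x [].
  - exists (Z.max B (Z.abs x)); intros y [<- | Hy]; [lia | specialize (HB y Hy); lia].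
Qed.

Lemma pow_le_one (x : R) (k : nat) : 0 <= x <= 1 -> x ^ k <= 1.
Proof. intros Hx; apply Rle_trans with (1 ^ k); [now apply pow_incr | rewrite pow1; lra]. Qed.

Lemma pow_small (q e : R) : 0 <= q < 1 -> 0 < e -> exists k : nat, q ^ k < e.
Proof.
  intros Hq He.
  destruct (pow_lt_1_zero q ltac:(rewrite Rabs_right; lra) e He) as [k Hk].
  exists k; eapply Rle_lt_trans; [apply Rle_abs | apply Hk; lia].
Qed.

(** At scale 1 every integer qualifies. From scale [4^-k] to the next, subtracting a net point from
    a member improves the radius by a factor 4; the net is finite, so gaps stay bounded. *)
Lemma bohr_syndetic (F : list R) (e : R) : 0 < e ->
  exists L : Z, (0 < L)%Z /\ forall u : Z, exists n, (u <= n < u + L)%Z /\ bohr F e n.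
Proof.
  intros He.
  assert (Hk : forall k : nat, exists L : Z, (0 < L)%Z /\
    forall u : Z, exists n, (u <= n < u + L)%Z /\ bohr F ((1 / 4) ^ k) n).
  { induction k as [ | k [L [HL HLn]]].
    - exists 1%Z; split; [lia | intros u; exists u; split; [lia | ]].
      intros f _; apply (near_weaken (1 / 2)); [simpl; lra | apply near_half].
    - destruct (bohr_net F ((1 / 4) ^ k) (bohr F ((1 / 4) ^ k))) as [X (_ & _ & HX)];
        [apply pow_lt; lra | tauto | ].
      destruct (list_Z_bounded X) as [B HB].
      (* The member is sought from [u + |B|] on, so that subtracting a net point of size at most
         [|B|] stays inside the window starting at [u]. *)
      exists (L + 2 * Z.abs B)%Z; split; [lia | intros u].
      destruct (HLn (u + Z.abs B)%Z) as [n [Hn Hb]].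
      destruct (HX n Hb) as [x [Hx Hbx]].
      exists (n - x)%Z; split; [specialize (HB x Hx); lia | ].
      apply (bohr_weaken F ((1 / 4) ^ k / 4)); [simpl; lra | exact Hbx]. }
  destruct (pow_small (1 / 4) e) as [k Hke]; [lra | exact He | ].
  destruct (Hk k) as [L [HL HLn]].
  exists L; split; [exact HL | intros u; destruct (HLn u) as [n [Hn Hb]]].
  exists n; split; [exact Hn | apply (bohr_weaken F ((1 / 4) ^ k)); [lra | exact Hb]].
Qed.

(** If [y] is within less than 1/3 of [z] and [2 y] within 1/3 of [z'], then [|z' - 2 z| < 1], so
    [z' = 2 z] and the distance of [y] is half that of [2 y]. *)
Lemma near_of_doublings (k : nat) (y : R) :
  (forall j, (j <= k)%nat -> dist_Z (2 ^ j * y) < 1 / 3) -> near (1 / 3 * (1 / 2) ^ k) y.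
Proof.
  revert y; induction k as [ | k IH]; intros y Hy.
  - apply (near_weaken (dist_Z y)); [ | apply near_dist_Z].
    specialize (Hy 0%nat (le_n _)); simpl in *; rewrite Rmult_1_l in Hy; lra.
  - assert (H2 : near (1 / 3 * (1 / 2) ^ k) (2 * y)).
    { apply IH; intros j Hj.
      replace (2 ^ j * (2 * y)) with (2 ^ S j * y) by (simpl; ring).
      apply (Hy (S j)); lia. }
    assert (Hc : (1 / 2) ^ k <= 1) by (apply pow_le_one; lra).
    destruct (near_dist_Z y) as [z Hz].
    specialize (Hy 0%nat ltac:(lia)); rewrite pow_O, Rmult_1_l in Hy.
    destruct H2 as [z' Hz'].
    assert (Hzz : z' = (2 * z)%Z).
    { apply Rabs_le_between in Hz; apply Rabs_le_between in Hz'.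
      assert (-1 < IZR z' - 2 * IZR z < 1) as [H1 H2] by lra.
      rewrite <- mult_IZR, <- minus_IZR in H1, H2.
      apply lt_IZR in H1; apply lt_IZR in H2; lia. }
    subst z'; exists z; rewrite mult_IZR in Hz'.
    apply Rabs_le_between in Hz'; apply Rabs_le; simpl pow; lra.
Qed.

(** * Killing sets *)

Definition sum_over {A : Type} (u : A -> R) (l : list A) : R :=
  fold_right (fun a s => u a + s) 0 l.

Lemma sum_over_app {A : Type} (u : A -> R) (l l' : list A) :
  sum_over u (l ++ l') = sum_over u l + sum_over u l'.
Proof. induction l as [ | a l IH]; simpl; [ring | rewrite IH; ring]. Qed.

Lemma sum_over_le_const {A : Type} (u : A -> R) (c : R) (l : list A) :
  (forall a, In a l -> u a <= c) -> sum_over u l <= INR (length l) * c.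
Proof.
  induction l as [ | a l IH]; intros H.
  - simpl; lra.
  - change (length (a :: l)) with (S (length l)); rewrite S_INR; simpl sum_over.
    pose proof (H a (or_introl eq_refl)).
    assert (sum_over u l <= INR (length l) * c) by (apply IH; intros; apply H; now right).
    lra.
Qed.

Lemma rpow_ge0 (x r : R) : 0 <= rpow x r.
Proof.
  unfold rpow; destruct (Req_EM_T x 0); [lra | unfold Rpower; left; apply exp_pos].
Qed.

(** For a base at most 1 the power decreases in the exponent, so one bound at the exponent [r]
    serves all larger ones. *)
Lemma rpow_le_Rpower (x e r r' : R) :
  0 <= x <= e -> 0 < e <= 1 -> 0 < r <= r' -> rpow x r' <= Rpower e r.
Proof.
  intros Hx He Hr; unfold rpow; destruct (Req_EM_T x 0).
  - unfold Rpower; left; apply exp_pos.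
  - apply Rle_trans with (Rpower e r'); [apply Rle_Rpower_l; lra | ].
    unfold Rpower.
    assert (ln e <= 0).
    { rewrite <- ln_1; destruct (proj2 He) as [H | ->]; [left; apply ln_increasing; lra | lra]. }
    destruct (Rle_lt_or_eq_dec (r' * ln e) (r * ln e)) as [H1 | H1]; [nra | | ].
    + left; now apply exp_increasing.
    + rewrite H1; lra.
Qed.

(* Both [w] and [w + a] survive only if [a beta] is within 1/3 of an integer, and below 1/3
   doubling is injective enough to halve the distance: this is where 1/6 comes from. *)
Lemma killing_level (F : list R) (T k : nat) (X : list Z) :
  (forall x, In x X -> (0 <= x)%Z /\ bohr F ((1 / 4) ^ k) x) ->
  exists A : list nat,
    length A = S (S k * length X) /\
    (forall a, In a A -> (T < a)%nat /\ bohr F (2 * (1 / 2) ^ k) (Z.of_nat a)) /\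
    forall beta, (forall a, In a A -> dist_Z (INR a * beta) < 1 / 6) ->
      forall x, In x X -> near (1 / 3 * (1 / 2) ^ k) (IZR x * beta).
Proof.
  intros HX.
  assert (Hk : 0 < (1 / 2) ^ k) by (apply pow_lt; lra).
  destruct (bohr_syndetic F ((1 / 2) ^ k) Hk) as [L [_ HL]].
  destruct (HL (Z.of_nat T + 1)%Z) as [w [[Hw _] Hbw]].
  (* The set is [w] together with all [w + 2^j x], [j <= k]; taking [w > T] pushes every element
     beyond [T]. *)
  exists (Z.to_nat w :: map (fun p => Z.to_nat (w + 2 ^ Z.of_nat (fst p) * snd p)%Z)
                            (list_prod (seq 0 (S k)) X)).
  split; [ | split].
  - cbn [length]; rewrite length_map, length_prod, length_seq; reflexivity.
  - intros a [<- | Ha].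
    + split; [lia | ]; rewrite Z2Nat.id by lia.
      apply (bohr_weaken F ((1 / 2) ^ k)); [lra | exact Hbw].
    + apply in_map_iff in Ha; destruct Ha as [[j x] [<- Hjx]].
      apply in_prod_iff in Hjx; destruct Hjx as [Hj Hx]; apply in_seq in Hj.
      destruct (HX x Hx) as [Hx0 Hbx].
      assert (H2 : (0 < 2 ^ Z.of_nat j)%Z) by (apply Z.pow_pos_nonneg; lia).
      cbn [fst snd].
      split; [nia | ]; rewrite Z2Nat.id by nia.
      replace (2 * (1 / 2) ^ k) with ((1 / 2) ^ k + (1 / 2) ^ k) by ring.
      apply bohr_add; [exact Hbw | ].
      apply (bohr_weaken F (IZR (2 ^ Z.of_nat j) * (1 / 4) ^ k));
        [ | apply bohr_mult; [lia | exact Hbx]].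
      rewrite <- pow_IZR.
      (* The scale [4^-k] leaves room for [k] doublings: [2^j 4^-k <= 2^-k]. *)
      replace ((1 / 2) ^ k) with (2 ^ k * (1 / 4) ^ k)
        by (rewrite <- Rpow_mult_distr; f_equal; field).
      apply Rmult_le_compat_r; [apply pow_le; lra | apply Rle_pow; [lra | lia]].
  - intros beta Hbeta x Hx; apply near_of_doublings; intros j Hj.
    destruct (HX x Hx) as [Hx0 _].
    assert (H2 : (0 < 2 ^ Z.of_nat j)%Z) by (apply Z.pow_pos_nonneg; lia).
    assert (Hd : near (dist_Z (INR (Z.to_nat (w + 2 ^ Z.of_nat j * x)) * beta)
                       + dist_Z (INR (Z.to_nat w) * beta)) (2 ^ j * (IZR x * beta))).
    { replace (2 ^ j * (IZR x * beta)) with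
        (INR (Z.to_nat (w + 2 ^ Z.of_nat j * x)) * beta - INR (Z.to_nat w) * beta).
      - apply near_sub; apply near_dist_Z.
      - rewrite !INR_IZR_INZ, !Z2Nat.id, plus_IZR, mult_IZR, <- pow_IZR by nia; ring. }
    apply dist_Z_le_near in Hd.
    assert (H1 := Hbeta (Z.to_nat w) (or_introl eq_refl)).
    assert (H3 : dist_Z (INR (Z.to_nat (w + 2 ^ Z.of_nat j * x)) * beta) < 1 / 6).
    { apply Hbeta; right; apply in_map_iff; exists (j, x); split; [reflexivity | ].
      apply in_prod; [apply in_seq; lia | exact Hx]. }
    lra.
Qed.

(** Each of [1, s, ..., s^k] is at least [s^k], and together they stay below the full geometric
    series. This absorbs the factor [k + 1] coming from the number of doublings. *)
Lemma succ_mul_pow_le (s : R) (k : nat) : 0 <= s < 1 -> (INR k + 1) * s ^ k <= / (1 - s).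
Proof.
  intros Hs; apply (Rmult_le_reg_r (1 - s)); [lra | rewrite Rinv_l by lra].
  enough (H : (INR k + 1) * s ^ k * (1 - s) <= 1 - s ^ S k)
    by (assert (0 <= s ^ S k) by (apply pow_le; lra); lra).
  induction k as [ | k IH]; [simpl; lra | ].
  rewrite S_INR; assert (0 <= s ^ k) by (apply pow_le; lra).
  assert (0 <= INR k) by apply pos_INR.
  simpl pow in *.
  assert (0 <= s ^ k * (1 - s) * (1 - s)) by (repeat apply Rmult_le_pos; lra).
  assert (0 <= INR k * (s ^ k * (1 - s) * (1 - s))) by (apply Rmult_le_pos; lra).
  nra.
Qed.

Lemma list_of_Z_range (P : Z -> Prop) (N : nat) :
  exists X : list Z, (length X <= N)%nat /\
    forall x, In x X <-> (0 <= x < Z.of_nat N)%Z /\ P x.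
Proof.
  induction N as [ | N [X [HX1 HX2]]].
  - exists []; split; [simpl; lia | intros x; simpl; lia].
  - destruct (classic (P (Z.of_nat N))) as [HP | HP].
    + exists (Z.of_nat N :: X); split; [simpl; lia | intros x; cbn [In]; rewrite HX2].
      split.
      * intros [<- | [H1 H2]]; split; (assumption || lia).
      * intros [H1 H2]; destruct (Z.eq_dec x (Z.of_nat N)) as [-> | ?]; [now left | right].
        split; [lia | assumption].
    + exists X; split; [lia | intros x; rewrite HX2].
      split; intros [H1 H2]; split; auto; [lia | ].
      destruct (Z.eq_dec x (Z.of_nat N)) as [-> | ?]; [contradiction | lia].
Qed.

(** The square root of [2^-r]. A point at level [k] costs a multiple of [rate r ^ k * rate r ^ k]:
    one factor absorbs the number of doublings, the other leaves a geometric series over the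
    levels. *)
Definition rate (r : R) : R := Rpower (1 / 2) (r / 2).

Lemma rate_bounds (r : R) : 0 < r -> 0 < rate r < 1.
Proof.
  intros Hr; unfold rate; split; [unfold Rpower; apply exp_pos | ].
  rewrite <- (Rpower_O (1 / 2)) at 2 by lra; unfold Rpower; apply exp_increasing.
  assert (ln (1 / 2) < 0) by (rewrite <- ln_1; apply ln_increasing; lra).
  nra.
Qed.

Lemma Rpower_half_pow (k : nat) (r : R) :
  Rpower (2 * (1 / 2) ^ k) r = Rpower 2 r * (rate r ^ k * rate r ^ k).
Proof.
  assert (0 < (1 / 2) ^ k) by (apply pow_lt; lra).
  unfold rate; rewrite <- Rpower_mult_distr by lra; f_equal.
  rewrite <- Rpow_mult_distr, <- Rpower_plus.
  rewrite <- !Rpower_pow by (try lra; unfold Rpower; apply exp_pos).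
  rewrite !Rpower_mult; f_equal; field.
Qed.

(** The constant 2/3 is the one preserved from level to level:
    [1/3 * 2^-k + 2/3 * 2^-(k+1) = 2/3 * 2^-k]. *)
Definition kills (F : list R) (r : R) (T : nat) (N : Z) (k : nat) (c : R) (A : list nat) : Prop :=
  A <> [] /\
  (forall a, In a A -> (T < a)%nat) /\
  (forall f, In f F -> forall r', r <= r' ->
     sum_over (fun a => rpow (dist_Z (INR a * f)) r') A <= c) /\
  forall beta, (forall a, In a A -> dist_Z (INR a * beta) < 1 / 6) ->
    forall n, (0 <= n <= N)%Z -> bohr F ((1 / 4) ^ k) n ->
      near (2 / 3 * (1 / 2) ^ k) (IZR n * beta).

(** With at most [C] translations a level has at most [(1 + C) (k + 1)] points, each costing at most
    [(2 * 2^-k)^r]; multiplied by [rate r ^ k] this bounds the total. *)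
Definition level_cost (r : R) (C : nat) : R := (1 + INR C) * Rpower 2 r / (1 - rate r).

Lemma level_cost_bound (F : list R) (r : R) (k C : nat) (X : list Z) (A : list nat) :
  0 < r -> (1 <= k)%nat -> (length X <= C)%nat -> length A = S (S k * length X) ->
  (forall a, In a A -> bohr F (2 * (1 / 2) ^ k) (Z.of_nat a)) ->
  forall f, In f F -> forall r', r <= r' ->
    sum_over (fun a => rpow (dist_Z (INR a * f)) r') A <= level_cost r C * rate r ^ k.
Proof.
  intros Hr Hk HX HA Hb f Hf r' Hr'.
  pose proof (rate_bounds r Hr) as Hs.
  assert (Hk2 : 0 < 2 * (1 / 2) ^ k <= 1).
  { assert (0 < (1 / 2) ^ k) by (apply pow_lt; lra).
    destruct k as [ | k]; [lia | ].
    assert ((1 / 2) ^ k <= 1) by (apply pow_le_one; lra).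
    simpl pow in *; lra. }
  eapply Rle_trans; [apply (sum_over_le_const _ (Rpower (2 * (1 / 2) ^ k) r)) | ].
  - intros a Ha; apply rpow_le_Rpower; [ | exact Hk2 | lra].
    split; [apply dist_Z_ge0 | apply dist_Z_le_near].
    rewrite INR_IZR_INZ; now apply Hb.
  - rewrite HA, Rpower_half_pow.
    assert (Hlen : INR (S (S k * length X)) <= (1 + INR C) * (INR k + 1)).
    { apply le_INR in HX; rewrite S_INR, mult_INR, S_INR.
      pose proof (pos_INR k); pose proof (pos_INR (length X)); nra. }
    pose proof (succ_mul_pow_le (rate r) k ltac:(lra)) as Hg.
    assert (H2 : 0 < Rpower 2 r) by (unfold Rpower; apply exp_pos).
    assert (H3 : 0 < rate r ^ k) by (apply pow_lt; lra).
    pose proof (pos_INR C).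
    apply Rle_trans with ((1 + INR C) * (INR k + 1) * (Rpower 2 r * (rate r ^ k * rate r ^ k))).
    + apply Rmult_le_compat_r; [ | exact Hlen].
      apply Rmult_le_pos; [lra | apply Rmult_le_pos; lra].
    + unfold level_cost, Rdiv.
      replace ((1 + INR C) * (INR k + 1) * (Rpower 2 r * (rate r ^ k * rate r ^ k)))
        with ((1 + INR C) * Rpower 2 r * rate r ^ k * ((INR k + 1) * rate r ^ k)) by ring.
      replace ((1 + INR C) * Rpower 2 r * / (1 - rate r) * rate r ^ k)
        with ((1 + INR C) * Rpower 2 r * rate r ^ k * / (1 - rate r)) by ring.
      apply Rmult_le_compat_l; [ | exact Hg].
      repeat apply Rmult_le_pos; lra.
Qed.

(** The deepest level takes every member of the Bohr set up to [N] as a translation. The cost grows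
    with [N], but the level can be chosen after [N] to make it small. *)
Lemma kills_last (F : list R) (r : R) (T : nat) (N : nat) (k : nat) :
  0 < r -> (1 <= k)%nat ->
  exists A, kills F r T (Z.of_nat N) k (level_cost r (S N) * rate r ^ k) A.
Proof.
  intros Hr Hk.
  destruct (list_of_Z_range (bohr F ((1 / 4) ^ k)) (S N)) as [X [HX1 HX2]].
  destruct (killing_level F T k X) as [A (HA1 & HA2 & HA3)].
  { intros x Hx; apply HX2 in Hx; split; [lia | tauto]. }
  exists A; split; [intros ->; discriminate | split; [intros a Ha; now apply HA2 | split]].
  - apply (level_cost_bound F r k (S N) X A); auto; intros a Ha; now apply HA2.
  - intros beta Hb n Hn Hbn; apply (near_weaken (1 / 3 * (1 / 2) ^ k)).
    + assert (0 < (1 / 2) ^ k) by (apply pow_lt; lra); lra.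
    + apply HA3; [exact Hb | apply HX2; split; [lia | exact Hbn]].
Qed.

(** Write [n = x + (n - x)] with [x] in the net of level [k] and [n - x] in the Bohr set of level
    [k + 1]. The new points control [x], the old set controls [n - x], and the cost of the new
    points does not involve [N]. *)
Lemma kills_step (F : list R) (r : R) (T : nat) (N : Z) (k : nat) (c : R) (A : list nat) :
  0 < r -> (1 <= k)%nat -> kills F r T N (S k) c A ->
  exists A', kills F r T N k (level_cost r (8 ^ length F) * rate r ^ k + c) A'.
Proof.
  intros Hr Hk (HA0 & HA1 & HA2 & HA3).
  destruct (bohr_net F ((1 / 4) ^ k) (fun n => (0 <= n <= N)%Z /\ bohr F ((1 / 4) ^ k) n))
    as [X (HX1 & HX2 & HX3)]; [apply pow_lt; lra | tauto | ].
  destruct (killing_level F T k X) as [B (HB1 & HB2 & HB3)].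
  { intros x Hx; apply HX2 in Hx; split; [lia | tauto]. }
  exists (B ++ A); split; [destruct B; discriminate | split; [ | split]].
  - intros a Ha; apply in_app_or in Ha; destruct Ha as [Ha | Ha]; [now apply HB2 | auto].
  - intros f Hf r' Hr'; rewrite sum_over_app; apply Rplus_le_compat; [ | now apply HA2].
    apply (level_cost_bound F r k (8 ^ length F) X B); auto; intros a Ha; now apply HB2.
  - intros beta Hb n Hn Hbn.
    destruct (HX3 n (conj Hn Hbn)) as [x [Hx Hbx]].
    pose proof (HB3 beta (fun a Ha => Hb a (in_or_app _ _ _ (or_introl Ha))) x Hx) as H1.
    assert (Hbx' : bohr F ((1 / 4) ^ S k) (n - x)).
    { apply (bohr_weaken F ((1 / 4) ^ k / 4)); [simpl; lra | exact Hbx]. }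
    assert (H2 : near (2 / 3 * (1 / 2) ^ S k) (IZR (n - x) * beta)).
    { pose proof (HA3 beta (fun a Ha => Hb a (in_or_app _ _ _ (or_intror Ha)))) as H.
      destruct (HX2 x Hx) as [Hx0 _].
      (* Both [x] and [n] lie in [[0, N]], so [|n - x| <= N]; a negative difference is handled by
         symmetry. *)
      destruct (Z_le_gt_dec x n) as [Hle | Hgt].
      - apply H; [lia | exact Hbx'].
      - replace (IZR (n - x) * beta) with (- (IZR (- (n - x)) * beta))
          by (rewrite opp_IZR; ring).
        apply near_opp, H; [lia | now apply bohr_opp]. }
    replace (IZR n * beta) with (IZR x * beta + IZR (n - x) * beta)
      by (rewrite minus_IZR; ring).
    apply (near_weaken (1 / 3 * (1 / 2) ^ k + 2 / 3 * (1 / 2) ^ S k)); [simpl; lra | ].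
    now apply near_add.
Qed.

(** The radius [e] is fixed before [T] and [N]: from the level [k0] on, all net levels together cost
    at most [delta / 2], and the other half pays for a last level whose depth depends on [N]. *)
Lemma killing_set (F : list R) (r delta : R) : 0 < r -> 0 < delta ->
  exists e, 0 < e <= 1 / 64 /\ forall T N : nat, exists A : list nat,
    A <> [] /\ (forall a, In a A -> (T < a)%nat) /\
    (forall f, In f F -> forall r', r <= r' ->
       sum_over (fun a => rpow (dist_Z (INR a * f)) r') A <= delta) /\
    forall beta, (forall a, In a A -> dist_Z (INR a * beta) < 1 / 6) ->
      forall n, (0 <= n <= Z.of_nat N)%Z -> bohr F e n -> near (1 / 12) (IZR n * beta).
Proof.
  intros Hr Hd; pose proof (rate_bounds r Hr) as Hs.
  set (M := fun C => level_cost r C).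
  assert (HM : forall C, 0 < M C).
  { intros C; unfold M, level_cost; apply Rdiv_lt_0_compat; [ | lra].
    apply Rmult_lt_0_compat; [pose proof (pos_INR C); lra | unfold Rpower; apply exp_pos]. }
  set (D := (8 ^ length F)%nat).
  destruct (pow_small (rate r) (delta / 2 * (1 - rate r) / M D)) as [k1 Hk1]; [lra | | ].
  { apply Rdiv_lt_0_compat; [nra | apply HM]. }
  (* The extra 3 gives [4^-k0 <= 1/64] and [2/3 * 2^-k0 <= 1/12]. *)
  set (k0 := (k1 + 3)%nat).
  assert (Hanti : forall a b, rate r ^ (a + b) <= rate r ^ a).
  { intros a b; rewrite pow_add.
    assert (0 < rate r ^ a) by (apply pow_lt; lra).
    assert (rate r ^ b <= 1) by (apply pow_le_one; lra).
    nra. }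
  assert (H3 : forall x : R, 0 <= x <= 1 -> x ^ k0 <= x ^ 3).
  { intros x Hx; unfold k0; rewrite pow_add.
    assert (x ^ k1 <= 1) by (apply pow_le_one; lra).
    assert (0 <= x ^ 3) by (apply pow_le; lra); nra. }
  assert (Hk0 : M D * rate r ^ k0 / (1 - rate r) <= delta / 2).
  { pose proof (Hanti k1 3%nat) as Hle; fold k0 in Hle.
    apply (Rmult_le_reg_r (1 - rate r)); [lra | ].
    unfold Rdiv at 1; rewrite Rmult_assoc, Rinv_l, Rmult_1_r by lra.
    apply Rle_trans with (M D * (delta / 2 * (1 - rate r) / M D)).
    - apply Rmult_le_compat_l; [left; apply HM | lra].
    - right; field; apply Rgt_not_eq, HM. }
  exists ((1 / 4) ^ k0); split.
  { split; [apply pow_lt; lra | specialize (H3 (1 / 4) ltac:(lra)); lra]. }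
  intros T N.
  destruct (pow_small (rate r) (delta / 2 / M (S N))) as [d Hdd]; [lra | | ].
  { apply Rdiv_lt_0_compat; [lra | apply HM]. }
  (* descend from level [k0 + d], telescoping the geometric series of the level costs *)
  assert (Hdown : forall i k, (1 <= k)%nat ->
    (exists A, kills F r T (Z.of_nat N) (k + i) (delta / 2) A) ->
    exists A, kills F r T (Z.of_nat N) k (delta / 2 + M D * rate r ^ k / (1 - rate r)) A).
  { assert (Hmono : forall k c c' A, c <= c' ->
      kills F r T (Z.of_nat N) k c A -> kills F r T (Z.of_nat N) k c' A).
    { intros k c c' A Hc (H0 & H1 & H2 & H4); split; [ | split; [ | split]]; auto.
      intros f Hf r' Hr'; eapply Rle_trans; [apply H2; auto | exact Hc]. }
    induction i as [ | i IH]; intros k Hk [A HA].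
    - exists A; rewrite Nat.add_0_r in HA; apply (Hmono k (delta / 2)); [ | exact HA].
      assert (0 < M D * rate r ^ k / (1 - rate r)); [ | lra].
      apply Rdiv_lt_0_compat; [ | lra].
      apply Rmult_lt_0_compat; [apply HM | apply pow_lt; lra].
    - destruct (IH (S k) ltac:(lia)) as [B HB].
      { exists A; now replace (S k + i)%nat with (k + S i)%nat by lia. }
      destruct (kills_step F r T _ k _ B Hr Hk HB) as [B' HB'].
      exists B'; apply (Hmono k (level_cost r (8 ^ length F) * rate r ^ k
        + (delta / 2 + M D * rate r ^ S k / (1 - rate r)))); [ | exact HB'].
      change (level_cost r (8 ^ length F)) with (M D).
      right; simpl pow; field; lra. }
  destruct (Hdown d k0 ltac:(unfold k0; lia)) as [A (HA0 & HA1 & HA2 & HA3)].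
  { destruct (kills_last F r T N (k0 + d) Hr ltac:(unfold k0; lia))
      as [A (HA0 & HA1 & HA2 & HA3)].
    exists A; split; [ | split; [ | split]]; auto.
    intros f Hf r' Hr'; eapply Rle_trans; [now apply HA2 | ].
    change (level_cost r (S N)) with (M (S N)).
    apply Rle_trans with (M (S N) * (delta / 2 / M (S N))).
    - apply Rmult_le_compat_l; [left; apply HM | ].
      rewrite Nat.add_comm; eapply Rle_trans; [apply Hanti | lra].
    - right; field; apply Rgt_not_eq, HM. }
  exists A; split; [exact HA0 | split; [exact HA1 | split]].
  - intros f Hf r' Hr'; eapply Rle_trans; [now apply HA2 | lra].
  - intros beta Hb n Hn Hbn; apply (near_weaken (2 / 3 * (1 / 2) ^ k0)); [ | now apply HA3].
    specialize (H3 (1 / 2) ltac:(lra)); lra.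
Qed.

(** * Trigonometric polynomials *)

Definition cos1 (x : R) : R := cos (2 * PI * x).

Lemma cos1_add_Z (x : R) (z : Z) : cos1 (x + IZR z) = cos1 x.
Proof.
  unfold cos1; destruct (Z_le_gt_dec 0 z) as [Hz | Hz].
  - rewrite <- (cos_period (2 * PI * x) (Z.to_nat z)); f_equal.
    rewrite INR_IZR_INZ, Z2Nat.id by lia; ring.
  - rewrite <- (cos_period (2 * PI * (x + IZR z)) (Z.to_nat (- z))); f_equal.
    rewrite INR_IZR_INZ, Z2Nat.id, opp_IZR by lia; ring.
Qed.

Lemma cos1_sub_Z (x : R) (z : Z) : cos1 (x - IZR z) = cos1 x.
Proof. rewrite <- (cos1_add_Z (x - IZR z) z); f_equal; ring. Qed.

Lemma cos1_Rabs (x : R) : cos1 (Rabs x) = cos1 x.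
Proof.
  unfold Rabs; destruct (Rcase_abs x); [ | reflexivity].
  unfold cos1; rewrite <- cos_neg; f_equal; ring.
Qed.

Lemma cos1_decr (x y : R) : 0 <= x <= y -> y <= 1 / 2 -> cos1 y <= cos1 x.
Proof.
  intros Hx Hy; pose proof PI_RGT_0; unfold cos1.
  apply cos_decr_1; nra.
Qed.

Lemma cos1_near_ge (e x : R) : e <= 1 / 2 -> near e x -> cos1 e <= cos1 x.
Proof.
  intros He [z Hz]; rewrite <- (cos1_sub_Z x z), <- (cos1_Rabs (x - IZR z)).
  apply cos1_decr; [split; [apply Rabs_pos | exact Hz] | exact He].
Qed.

Lemma cos1_not_near_le (e x : R) : 0 <= e -> ~ near e x -> cos1 x <= cos1 e.
Proof.
  intros He Hx; destruct (near_half x) as [z Hz].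
  rewrite <- (cos1_sub_Z x z), <- (cos1_Rabs (x - IZR z)).
  apply cos1_decr; [split; [exact He | ] | exact Hz].
  destruct (Rle_dec (Rabs (x - IZR z)) e); [exfalso; apply Hx; now exists z | lra].
Qed.

Lemma cos1_lt_1 (e : R) : 0 < e <= 1 / 2 -> cos1 e < 1.
Proof.
  intros He; pose proof PI_RGT_0; unfold cos1; rewrite <- cos_0.
  apply cos_decreasing_1; nra.
Qed.

Lemma cos1_sixth : cos1 (1 / 6) = 1 / 2.
Proof. unfold cos1; rewrite <- cos_PI3; f_equal; field. Qed.

Definition psum (u : nat -> R) (n : nat) : R := sum_over u (seq 0 n).

Lemma psum_S (u : nat -> R) (n : nat) : psum u (S n) = psum u n + u n.
Proof. unfold psum; rewrite seq_S, sum_over_app; simpl; ring. Qed.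

Lemma psum_add (u : nat -> R) (m n : nat) :
  psum u (m + n) = psum u m + psum (fun i => u (m + i)%nat) n.
Proof.
  induction n as [ | n IH].
  - rewrite Nat.add_0_r; unfold psum at 3; simpl; ring.
  - rewrite Nat.add_succ_r, !psum_S, IH; ring.
Qed.

Lemma psum_ge_of_peak (w : nat -> R) (a b : R) (L i0 : nat) :
  0 <= a -> (forall i, (i < L)%nat -> - a <= w i) -> (i0 < L)%nat -> b <= w i0 ->
  b - INR L * a <= psum w L.
Proof.
  intros Ha Hw Hi Hb.
  assert (Hlow : forall n, (n <= L)%nat -> - (INR n * a) <= psum w n).
  { induction n as [ | n IH]; intros Hn; [unfold psum; simpl; lra | ].
    rewrite psum_S, S_INR; specialize (Hw n Hn); specialize (IH ltac:(lia)); lra. }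
  induction L as [ | L IH]; [lia | ].
  rewrite psum_S, S_INR.
  destruct (Nat.eq_dec i0 L) as [-> | Hne].
  - specialize (Hlow L ltac:(lia)); lra.
  - assert (IH' : b - INR L * a <= psum w L) by (apply IH; auto; lia).
    specialize (Hw L ltac:(lia)); lra.
Qed.

(** The Dirichlet kernel: multiplied by [2 sin (PI x)], each cosine becomes a difference of
    consecutive sines at odd multiples of [PI x]. The product form covers the zeros of the sine. *)
Lemma psum_cos1_telescope (x : R) (n : nat) :
  2 * sin (PI * x) * psum (fun i => cos1 (INR i * x)) n =
  sin ((2 * INR n - 1) * (PI * x)) + sin (PI * x).
Proof.
  induction n as [ | n IH].
  - unfold psum; simpl.
    replace ((2 * 0 - 1) * (PI * x)) with (- (PI * x)) by ring; rewrite sin_neg; ring.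
  - rewrite psum_S, Rmult_plus_distr_l, IH, S_INR; unfold cos1.
    replace ((2 * (INR n + 1) - 1) * (PI * x))
      with (2 * PI * (INR n * x) + PI * x) by ring.
    replace ((2 * INR n - 1) * (PI * x))
      with (2 * PI * (INR n * x) - PI * x) by ring.
    rewrite sin_plus, sin_minus; ring.
Qed.

(** Away from the integers [1 - cos1 e <= 1 - cos1 x = 2 sin^2 (PI x) <= 2 |sin (PI x)|], so the
    telescoped sum is bounded uniformly in [n]. *)
Lemma psum_cos1_bound (e x : R) (n : nat) : 0 < e <= 1 / 2 -> ~ near e x ->
  Rabs (psum (fun i => cos1 (INR i * x)) n) <= 2 / (1 - cos1 e).
Proof.
  intros He Hx.
  pose proof (cos1_lt_1 e He) as H1.
  pose proof (cos1_not_near_le e x ltac:(lra) Hx) as H2.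
  assert (Hsin : 1 - cos1 e <= 2 * Rabs (sin (PI * x))).
  { assert (Hc : cos1 x = 1 - 2 * sin (PI * x) * sin (PI * x)).
    { unfold cos1; replace (2 * PI * x) with (2 * (PI * x)) by ring; apply cos_2a_sin. }
    assert (Hs : Rabs (sin (PI * x)) <= 1) by (apply Rabs_le; apply SIN_bound).
    assert (Hss : sin (PI * x) * sin (PI * x) = Rabs (sin (PI * x)) * Rabs (sin (PI * x)))
      by (rewrite <- Rabs_mult; symmetry; apply Rabs_right, Rle_ge, Rle_0_sqr).
    pose proof (Rabs_pos (sin (PI * x))); nra. }
  pose proof (psum_cos1_telescope x n) as Ht.
  set (s := psum _ n) in *.
  assert (Hb : 2 * Rabs (sin (PI * x)) * Rabs s <= 2).
  { rewrite <- (Rabs_right 2) at 1 by lra; rewrite <- !Rabs_mult, Ht.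
    eapply Rle_trans; [apply Rabs_triang | ].
    assert (forall y, Rabs (sin y) <= 1) as Hy by (intros y; apply Rabs_le, SIN_bound).
    pose proof (Hy ((2 * INR n - 1) * (PI * x))); pose proof (Hy (PI * x)); lra. }
  apply (Rmult_le_reg_r (1 - cos1 e)); [lra | ].
  unfold Rdiv; rewrite Rmult_assoc, Rinv_l, Rmult_1_r by lra.
  pose proof (Rabs_pos s); nra.
Qed.

Definition trig_poly (l : list (R * R)) (n : nat) : R :=
  sum_over (fun p => fst p * cos1 (INR n * snd p)) l.

Lemma cos1_mul (x y : R) : cos1 x * cos1 y = / 2 * cos1 (x + y) + / 2 * cos1 (x - y).
Proof.
  unfold cos1.
  rewrite Rmult_plus_distr_l, Rmult_minus_distr_l, cos_plus, cos_minus; field.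
Qed.

Definition subgroup (G : R -> Prop) : Prop := G 0 /\ forall x y, G x -> G y -> G (x - y).

Lemma subgroup_opp (G : R -> Prop) (x : R) : subgroup G -> G x -> G (- x).
Proof. intros [H0 Hs] Hx; replace (- x) with (0 - x) by ring; auto. Qed.

Lemma subgroup_add (G : R -> Prop) (x y : R) : subgroup G -> G x -> G y -> G (x + y).
Proof.
  intros HG Hx Hy; replace (x + y) with (x - - y) by ring.
  apply HG; [exact Hx | now apply subgroup_opp].
Qed.

Definition is_trig (G : R -> Prop) (u : nat -> R) : Prop :=
  exists l, (forall p, In p l -> G (snd p)) /\ forall n, u n = trig_poly l n.

Lemma is_trig_one (G : R -> Prop) : subgroup G -> is_trig G (fun _ => 1).
Proof.
  intros HG; exists [(1, 0)]; split.
  - intros p [<- | []]; apply HG.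
  - intros n; unfold trig_poly, cos1; simpl; rewrite !Rmult_0_r, cos_0; ring.
Qed.

Lemma is_trig_ext (G : R -> Prop) (u v : nat -> R) :
  (forall n, u n = v n) -> is_trig G u -> is_trig G v.
Proof. intros H [l [Hl Hu]]; exists l; split; [exact Hl | intros n; now rewrite <- H]. Qed.

Lemma is_trig_mul_factor (G : R -> Prop) (u : nat -> R) (f : R) :
  subgroup G -> G f -> is_trig G u -> is_trig G (fun n => (1 + cos1 (INR n * f)) / 2 * u n).
Proof.
  intros HG Hf [l [Hl Hu]].
  (* Product-to-sum: each frequency [x] yields [x], [f + x] and [f - x], all in the subgroup. *)
  exists (flat_map (fun p => [(fst p / 2, snd p); (fst p / 4, f + snd p);
                              (fst p / 4, f - snd p)]) l).
  split.
  - intros p Hp; apply in_flat_map in Hp; destruct Hp as [q [Hq Hp]].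
    specialize (Hl q Hq); destruct Hp as [<- | [<- | [<- | []]]]; simpl;
      [exact Hl | now apply subgroup_add | now apply HG].
  - intros n; rewrite Hu; clear Hl Hu; unfold trig_poly.
    induction l as [ | [w x] l IH]; [simpl; ring | ].
    simpl in *; rewrite <- IH.
    rewrite Rmult_plus_distr_l with (r1 := INR n), Rmult_minus_distr_l.
    assert (Hc := cos1_mul (INR n * f) (INR n * x)).
    set (c := cos1 (INR n * f)) in *; set (c' := cos1 (INR n * x)) in *.
    set (cp := cos1 (INR n * f + INR n * x)) in *.
    set (cm := cos1 (INR n * f - INR n * x)) in *.
    set (S := sum_over _ l) in *.
    replace ((1 + c) / 2 * (w * c' + S)) with (w / 2 * c' + w / 2 * (c * c') + (1 + c) / 2 * S)
      by field.
    rewrite Hc; field.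
Qed.

(** The product over [F] of [cos (PI n f) ^ (2 k)], a nonnegative weight that concentrates on Bohr
    sets as [k] grows. *)
Fixpoint bump (F : list R) (k : nat) (n : nat) : R :=
  match F with
  | [] => 1
  | f :: F' => ((1 + cos1 (INR n * f)) / 2) ^ k * bump F' k n
  end.

Lemma is_trig_bump (G : R -> Prop) (F : list R) (k : nat) :
  subgroup G -> (forall f, In f F -> G f) -> is_trig G (bump F k).
Proof.
  intros HG; induction F as [ | f F IH]; intros HF; [now apply is_trig_one | ].
  assert (HF' : is_trig G (bump F k)) by (apply IH; intros; apply HF; now right).
  assert (Hf : G f) by (apply HF; now left).
  assert (H : forall i, is_trig G (fun n => ((1 + cos1 (INR n * f)) / 2) ^ i * bump F k n)).
  { induction i as [ | i IHi].
    - apply (is_trig_ext G (bump F k)); [intros n; simpl; ring | exact HF'].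
    - eapply is_trig_ext; [ | exact (is_trig_mul_factor G _ f HG Hf IHi)].
      intros n; simpl; ring. }
  exact (H k).
Qed.

Lemma half_cos1_bounds (x : R) : 0 <= (1 + cos1 x) / 2 <= 1.
Proof. pose proof (COS_bound (2 * PI * x)); unfold cos1; lra. Qed.

Lemma bump_bounds (F : list R) (k n : nat) : 0 <= bump F k n <= 1.
Proof.
  induction F as [ | f F IH]; simpl; [lra | ].
  pose proof (half_cos1_bounds (INR n * f)) as H.
  assert (0 <= ((1 + cos1 (INR n * f)) / 2) ^ k) by (apply pow_le; lra).
  assert (((1 + cos1 (INR n * f)) / 2) ^ k <= 1) by (apply pow_le_one; lra).
  nra.
Qed.

Lemma bump_outside (F : list R) (e : R) (k n : nat) : 0 <= e ->
  ~ bohr F e (Z.of_nat n) -> bump F k n <= ((1 + cos1 e) / 2) ^ k.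
Proof.
  intros He Hn; induction F as [ | f F IH].
  - exfalso; apply Hn; intros f [].
  - simpl; pose proof (half_cos1_bounds (INR n * f)) as H.
    pose proof (bump_bounds F k n) as Hb.
    assert (H0 : 0 <= ((1 + cos1 (INR n * f)) / 2) ^ k) by (apply pow_le; lra).
    destruct (classic (near e (INR n * f))) as [Hf | Hf].
    + assert (((1 + cos1 (INR n * f)) / 2) ^ k <= 1) by (apply pow_le_one; lra).
      assert (bump F k n <= ((1 + cos1 e) / 2) ^ k); [ | nra].
      apply IH; intros HF; apply Hn; intros g [<- | Hg]; [ | now apply HF].
      now rewrite <- INR_IZR_INZ.
    + apply cos1_not_near_le in Hf; [ | exact He].
      assert (((1 + cos1 (INR n * f)) / 2) ^ k <= ((1 + cos1 e) / 2) ^ k)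
        by (apply pow_incr; lra).
      nra.
Qed.

Lemma bump_inside (F : list R) (e : R) (k n : nat) : e <= 1 / 2 ->
  bohr F e (Z.of_nat n) -> (((1 + cos1 e) / 2) ^ length F) ^ k <= bump F k n.
Proof.
  intros He; induction F as [ | f F IH]; intros Hn; simpl; [rewrite pow1; lra | ].
  rewrite Rpow_mult_distr; apply Rmult_le_compat.
  - apply pow_le, half_cos1_bounds.
  - apply pow_le, pow_le, half_cos1_bounds.
  - apply pow_incr; split; [apply half_cos1_bounds | ].
    assert (Hf := Hn f (or_introl eq_refl)); rewrite <- INR_IZR_INZ in Hf.
    apply cos1_near_ge in Hf; [lra | exact He].
  - apply IH; intros g Hg; apply Hn; now right.
Qed.

(** Multiplying by [cos1 (i beta)] shifts each frequency to [beta + x] and [beta - x]; neither is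
    close to an integer, so every resulting cosine sum is bounded independently of [n]. *)
Lemma trig_poly_correlation_bound (l : list (R * R)) (e beta : R) (n : nat) :
  0 < e <= 1 / 2 ->
  (forall p, In p l -> ~ near e (beta - snd p) /\ ~ near e (beta + snd p)) ->
  Rabs (psum (fun i => trig_poly l i * cos1 (INR i * beta)) n)
    <= sum_over (fun p => Rabs (fst p)) l * (2 / (1 - cos1 e)).
Proof.
  intros He; induction l as [ | [w x] l IH]; intros Hl.
  - assert (H0 : psum (fun i => trig_poly [] i * cos1 (INR i * beta)) n = 0).
    { induction n as [ | n IHn]; [reflexivity | ].
      rewrite psum_S, IHn; unfold trig_poly; simpl; ring. }
    rewrite H0, Rabs_R0; simpl; lra.
  - assert (Hsplit : psum (fun i => trig_poly ((w, x) :: l) i * cos1 (INR i * beta)) n =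
      w / 2 * psum (fun i => cos1 (INR i * (beta + x))) n
      + w / 2 * psum (fun i => cos1 (INR i * (beta - x))) n
      + psum (fun i => trig_poly l i * cos1 (INR i * beta)) n).
    { clear; induction n as [ | n IHn]; [unfold psum; simpl; ring | ].
      rewrite !psum_S, IHn.
      rewrite Rmult_plus_distr_l with (r1 := INR n), Rmult_minus_distr_l with (r1 := INR n).
      assert (Hc := cos1_mul (INR n * beta) (INR n * x)).
      unfold trig_poly; simpl; fold (trig_poly l n).
      set (c := cos1 (INR n * beta)) in *; set (c' := cos1 (INR n * x)) in *.
      set (cp := cos1 (INR n * beta + INR n * x)) in *.
      set (cm := cos1 (INR n * beta - INR n * x)) in *.
      replace (cp) with (2 * (c * c') - cm) by (rewrite Hc; field).
      unfold trig_poly; simpl; field. }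
    rewrite Hsplit; simpl.
    destruct (Hl (w, x) (or_introl eq_refl)) as [Hm Hp]; simpl in Hm, Hp.
    assert (Hbp := psum_cos1_bound e (beta + x) n He Hp).
    assert (Hbm := psum_cos1_bound e (beta - x) n He Hm).
    assert (Hrest := IH (fun p Hp => Hl p (or_intror Hp))).
    set (K := 2 / (1 - cos1 e)) in *.
    eapply Rle_trans; [apply Rabs_triang | rewrite Rmult_plus_distr_r].
    apply Rplus_le_compat; [ | exact Hrest].
    eapply Rle_trans; [apply Rabs_triang | rewrite !Rabs_mult].
    assert (Hw : Rabs (w / 2) = Rabs w / 2)
      by (unfold Rdiv; rewrite Rabs_mult, (Rabs_right (/ 2)) by lra; reflexivity).
    rewrite Hw; pose proof (Rabs_pos w); nra.
Qed.

(** Provides the inner radius at which the guaranteed height of a bump beats its height [q] outside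
    the larger Bohr set. *)
Lemma cos1_pow_near_1 (m : nat) (q e : R) : q < 1 -> 0 < e ->
  exists e', 0 < e' <= e /\ q < ((1 + cos1 e') / 2) ^ m.
Proof.
  intros Hq He.
  assert (Hcont : continuity_pt (fun x => ((1 + cos1 x) / 2) ^ m) 0).
  { apply (continuity_pt_comp (fun x => (1 + cos1 x) / 2) (fun y => y ^ m)).
    - unfold cos1; reg.
    - apply derivable_continuous_pt, derivable_pt_pow. }
  destruct (Hcont (1 - q) ltac:(lra)) as [d [Hd Hc]].
  (* Halving [d] keeps the point strictly inside the continuity neighbourhood; it is also nonzero,
     as that definition requires. *)
  exists (Rmin e (d / 2)); split.
  - split; [apply Rmin_pos; lra | apply Rmin_l].
  - assert (H0 : 0 < Rmin e (d / 2)) by (apply Rmin_pos; lra).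
    assert (H2 := Rmin_r e (d / 2)).
    assert (Hx := Hc (Rmin e (d / 2))).
    simpl in Hx; unfold R_dist, D_x, no_cond in Hx.
    replace (cos1 0) with 1 in Hx by (unfold cos1; rewrite Rmult_0_r, cos_0; reflexivity).
    replace ((1 + 1) / 2) with 1 in Hx by field; rewrite pow1 in Hx.
    assert (Hy : Rabs (((1 + cos1 (Rmin e (d / 2))) / 2) ^ m - 1) < 1 - q).
    { apply Hx; split; [split; [exact I | lra] | ].
      rewrite Rminus_0_r, Rabs_right; lra. }
    apply Rabs_def2 in Hy; lra.
Qed.

(* Correlate [beta] with [bump F k], which for large [k] is concentrated on the Bohr set but
   is a trigonometric polynomial with frequencies in [G]: a correlation growing linearly in
   the length of the interval forces [beta] to be close to one of these frequencies. *)
Lemma bohr_dual (G : R -> Prop) (F : list R) (e : R) :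
  subgroup G -> 0 < e <= 1 / 2 -> (forall f, In f F -> G f) ->
  exists D : list R, (forall d, In d D -> G d) /\
    forall eta, 0 < eta <= 1 / 2 -> exists N : nat, forall beta,
      (forall n, (0 <= n <= Z.of_nat N)%Z -> bohr F e n -> near (1 / 6) (IZR n * beta)) ->
      exists d, In d D /\ near eta (beta - d).
Proof.
  intros HG He HF.
  set (q := (1 + cos1 e) / 2).
  assert (Hq : 0 <= q < 1).
  { unfold q; pose proof (half_cos1_bounds e); pose proof (cos1_lt_1 e He); lra. }
  destruct (cos1_pow_near_1 (length F) q e) as [e' [He' HP]]; [lra | lra | ].
  set (P := ((1 + cos1 e') / 2) ^ length F) in *.
  destruct (bohr_syndetic F e' ltac:(lra)) as [Lz [HLz HL]].
  set (L := Z.to_nat Lz).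
  assert (HL0 : 0 < INR L) by (apply lt_0_INR; unfold L; lia).
  (* Every block of length [L] meets the inner Bohr set, where the bump is at least [P^k] and the
     cosine at least 1/2. Terms outside the outer Bohr set are at least [- q^k]. This [k] makes the
     net gain [c] of a block positive. *)
  destruct (pow_small (q / P) (/ (2 * INR L))) as [k Hk].
  { split; [apply Rmult_le_pos; [lra | left; apply Rinv_0_lt_compat; lra] | ].
    apply (Rmult_lt_reg_r P); [lra | ].
    unfold Rdiv; rewrite Rmult_assoc, Rinv_l; lra. }
  { apply Rinv_0_lt_compat; lra. }
  assert (HPk : 0 < P ^ k) by (apply pow_lt; lra).
  assert (Hqk : 0 <= q ^ k) by (apply pow_le; lra).
  set (c := P ^ k / 2 - INR L * q ^ k).
  assert (Hc : 0 < c).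
  { unfold Rdiv in Hk; rewrite Rpow_mult_distr, pow_inv in Hk.
    assert (q ^ k < P ^ k * / (2 * INR L)).
    { apply (Rmult_lt_reg_r (/ P ^ k)); [now apply Rinv_0_lt_compat | ].
      replace (P ^ k * / (2 * INR L) * / P ^ k) with (/ (2 * INR L)) by (field; lra).
      exact Hk. }
    assert (INR L * q ^ k < INR L * (P ^ k * / (2 * INR L)))
      by (apply Rmult_lt_compat_l; assumption).
    unfold c; replace (P ^ k / 2) with (INR L * (P ^ k * / (2 * INR L))) by (field; lra).
    lra. }
  destruct (is_trig_bump G F k HG HF) as [l [Hl Hu]].
  (* Both signs occur because the cosine is even. The list is fixed before [eta]; only the length of
     the interval depends on [eta]. *)
  exists (map snd l ++ map (fun p => - snd p) l); split.
  { intros d Hd; apply in_app_or in Hd; destruct Hd as [Hd | Hd];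
      apply in_map_iff in Hd; destruct Hd as [p [<- Hp]]; [auto | apply subgroup_opp; auto]. }
  intros eta Heta.
  (* If [beta] were far from all frequencies, the correlation would be at most [W]; with [J] blocks
     it is at least [J c > W]. *)
  set (W := sum_over (fun p => Rabs (fst p)) l * (2 / (1 - cos1 eta))).
  destruct (INR_unbounded (W / c)) as [J HJ].
  exists (J * L)%nat; intros beta Hbeta.
  apply NNPP; intros Hno.
  assert (Hup : Rabs (psum (fun i => bump F k i * cos1 (INR i * beta)) (J * L)) <= W).
  { replace (psum (fun i => bump F k i * cos1 (INR i * beta)) (J * L))
      with (psum (fun i => trig_poly l i * cos1 (INR i * beta)) (J * L)).
    - apply trig_poly_correlation_bound; [exact Heta | ].
      intros p Hp; split; intros Hnear; apply Hno.
      + exists (snd p); split; [apply in_or_app; left; now apply in_map | exact Hnear].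
      + exists (- snd p); split.
        * apply in_or_app; right; now apply (in_map (fun p => - snd p)).
        * now replace (beta - - snd p) with (beta + snd p) by ring.
    - unfold psum; induction (seq 0 (J * L)) as [ | i s IH]; [reflexivity | ].
      simpl; now rewrite IH, Hu. }
  assert (Hlow : forall j, (j <= J)%nat ->
    INR j * c <= psum (fun i => bump F k i * cos1 (INR i * beta)) (j * L)).
  { induction j as [ | j IH]; intros Hj; [unfold psum; simpl; lra | ].
    replace (S j * L)%nat with (j * L + L)%nat by lia.
    rewrite psum_add, S_INR.
    specialize (IH ltac:(lia)).
    enough (c <= psum (fun i => bump F k (j * L + i)
                               * cos1 (INR (j * L + i) * beta)) L) by lra.
    destruct (HL (Z.of_nat (j * L))) as [n [Hn Hbn]].
    set (w := fun i => bump F k (j * L + i) * cos1 (INR (j * L + i) * beta)).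
    assert (Hw : forall i, (i < L)%nat -> bohr F e (Z.of_nat (j * L + i)) ->
      1 / 2 <= cos1 (INR (j * L + i) * beta)).
    { intros i Hi Hb; rewrite <- cos1_sixth; apply cos1_near_ge; [lra | ].
      rewrite INR_IZR_INZ; apply Hbeta; [nia | exact Hb]. }
    set (i0 := Z.to_nat (n - Z.of_nat (j * L))).
    assert (Hi0 : (i0 < L)%nat) by (unfold i0, L; lia).
    assert (Hni : n = Z.of_nat (j * L + i0)) by (unfold i0; lia).
    apply (psum_ge_of_peak w (q ^ k) (P ^ k / 2) L i0 Hqk).
    - intros i Hi; unfold w; pose proof (bump_bounds F k (j * L + i)) as Hb.
      destruct (classic (bohr F e (Z.of_nat (j * L + i)))) as [Hin | Hout].
      + specialize (Hw i Hi Hin); nra.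
      + apply (bump_outside F e k) in Hout; [fold q in Hout | lra].
        pose proof (COS_bound (2 * PI * (INR (j * L + i) * beta))) as Hcb.
        fold (cos1 (INR (j * L + i) * beta)) in Hcb; nra.
    - exact Hi0.
    - unfold w; rewrite Hni in Hbn.
      assert (H1 := bump_inside F e' k (j * L + i0) ltac:(lra) Hbn); fold P in H1.
      specialize (Hw i0 Hi0 (bohr_weaken F e' e _ ltac:(lra) Hbn)); nra. }
  specialize (Hlow J (le_n J)).
  apply Rabs_le_between in Hup.
  apply (Rmult_lt_compat_r c) in HJ; [ | exact Hc].
  unfold Rdiv in HJ; rewrite Rmult_assoc, Rinv_l, Rmult_1_r in HJ by lra.
  lra.
Qed.

(** * Construction of the sequence *)

Lemma near_add_Z (e x : R) (z : Z) : near e x -> near e (x + IZR z).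
Proof.
  intros [y Hy]; exists (y + z)%Z; rewrite plus_IZR.
  now replace (x + IZR z - (IZR y + IZR z)) with (x - IZR y) by ring.
Qed.

Lemma dist_Z_add_Z (x : R) (z : Z) : dist_Z (x + IZR z) = dist_Z x.
Proof.
  apply Rle_antisym; apply dist_Z_le_near.
  - apply near_add_Z, near_dist_Z.
  - replace x with (x + IZR z + IZR (- z)) at 2 by (rewrite opp_IZR; ring).
    apply near_add_Z, near_dist_Z.
Qed.

(* The multiples [n gamma] advance by at most 1/4 along a syndetic set, so they cannot jump
   from one integer's neighbourhood to the next. *)
Lemma syndetic_multiples_small (B : Z -> Prop) (L N : Z) (gamma : R) :
  (forall u : Z, exists n, (u <= n < u + L)%Z /\ B n) ->
  (forall n, (0 <= n <= N)%Z -> B n -> near (1 / 8) (IZR n * gamma)) ->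
  Rabs gamma * IZR L <= 1 / 4 ->
  forall n, (0 <= n <= N)%Z -> B n -> Rabs (IZR n * gamma) <= 1 / 8.
Proof.
  intros HL Hnear Hg n Hn HB.
  assert (Hshift : forall m, (0 <= m <= L)%Z -> Rabs (IZR m * gamma) <= 1 / 4).
  { intros m [Hm1 Hm2]; rewrite Rabs_mult.
    apply IZR_le in Hm1; apply IZR_le in Hm2; rewrite (Rabs_right (IZR m)) by lra.
    pose proof (Rabs_pos gamma); nra. }
  (* Strong induction on [n]: a member of the window of length [L] just before [n] has its multiple
     within 1/8 of 0, the step adds at most 1/4, and 3/8 < 1/2 leaves 0 as the only possible nearest
     integer. *)
  enough (H : forall k n, (0 <= n < Z.of_nat k)%Z -> (n <= N)%Z -> B n ->
    Rabs (IZR n * gamma) <= 1 / 8)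
    by (apply (H (S (Z.to_nat n)) n); [lia | lia | exact HB]).
  clear n Hn HB.
  induction k as [ | k IH]; intros n Hn HnN HB; [lia | ].
  apply near_small; [lra | | apply Hnear; [lia | exact HB]].
  destruct (Z_le_gt_dec n L) as [Hle | Hgt].
  - pose proof (Hshift n ltac:(lia)); lra.
  - destruct (HL (n - L)%Z) as [m [Hm HBm]].
    pose proof (IH m ltac:(lia) ltac:(lia) HBm) as H1.
    pose proof (Hshift (n - m)%Z ltac:(lia)) as H2.
    replace (IZR n * gamma) with (IZR m * gamma + IZR (n - m) * gamma)
      by (rewrite minus_IZR; ring).
    eapply Rle_lt_trans; [apply Rabs_triang | lra].
Qed.

(** The clauses stay quantified over [eta] and [N]: both are chosen from the gap [L] of the
    following stage, which itself depends on the [D] produced here. *)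
Definition stage (G : R -> Prop) (t : nat) (F : list R) (s : R * Z * list R) : Prop :=
  let '(e, L, D) := s in
  0 < e <= 1 / 64 /\ (0 < L)%Z /\
  (forall u : Z, exists n, (u <= n < u + L)%Z /\ bohr F e n) /\
  (forall d, In d D -> G d) /\
  (forall eta, 0 < eta <= 1 / 2 -> exists N : nat, forall beta,
     (forall n, (0 <= n <= Z.of_nat N)%Z -> bohr F e n -> near (1 / 6) (IZR n * beta)) ->
     exists d, In d D /\ near eta (beta - d)) /\
  forall N : nat, exists A : list nat,
    A <> [] /\ (forall a, In a A -> (t < a)%nat) /\
    (forall f, In f F -> forall r, / INR (S t) <= r ->
       sum_over (fun a => rpow (dist_Z (INR a * f)) r) A <= (1 / 2) ^ t) /\
    forall beta, (forall a, In a A -> dist_Z (INR a * beta) < 1 / 6) ->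
      forall n, (0 <= n <= Z.of_nat N)%Z -> bohr F e n -> near (1 / 12) (IZR n * beta).

Lemma stage_exists (G : R -> Prop) (t : nat) (F : list R) :
  subgroup G -> (forall f, In f F -> G f) -> exists s, stage G t F s.
Proof.
  intros HG HF.
  destruct (killing_set F (/ INR (S t)) ((1 / 2) ^ t)) as [e [He Hkill]].
  { apply Rinv_0_lt_compat, lt_0_INR; lia. }
  { apply pow_lt; lra. }
  destruct (bohr_syndetic F e ltac:(lra)) as [L [HL0 HL]].
  destruct (bohr_dual G F e HG ltac:(lra) HF) as [D [HD1 HD2]].
  exists (e, L, D); repeat (split; [assumption | ]); intros N; apply Hkill.
Qed.

(** For a surviving [beta], the first clause starts an approximation by a point of [F']; the second
    tightens an existing one while keeping the same [d] and [z]. *)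
Definition separates (t : nat) (F F' : list R) (eta eta' : R) (A : list nat) : Prop :=
  A <> [] /\ (forall a, In a A -> (t < a)%nat) /\
  (forall f, In f F -> forall r, / INR (S t) <= r ->
     sum_over (fun a => rpow (dist_Z (INR a * f)) r) A <= (1 / 2) ^ t) /\
  forall beta, (forall a, In a A -> dist_Z (INR a * beta) < 1 / 6) ->
    (exists d, In d F' /\ near eta' (beta - d)) /\
    forall d gamma z, In d F -> beta = d + gamma + IZR z ->
      Rabs gamma <= eta -> Rabs gamma <= eta'.

Lemma separating_sets (alpha : nat -> R) : is_subgroup_T alpha ->
  exists (F : nat -> list R) (eta : nat -> R) (A : nat -> list nat),
    (forall t f, In f (F t) -> inG alpha f) /\
    (forall t, In (alpha t) (F t)) /\
    (forall t f, In f (F t) -> In f (F (S t))) /\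
    (forall t, eta (S t) <= / INR (S t)) /\
    forall t, separates t (F t) (F (S t)) (eta t) (eta (S t)) (A t).
Proof.
  intros HG; set (G := inG alpha).
  (* The implication sits under the existential so that the choice function is total on lists; a
     dummy triple serves lists outside [G]. *)
  assert (Hstep : forall t F, exists s, (forall f, In f F -> G f) -> stage G t F s).
  { intros t F; destruct (classic (forall f, In f F -> G f)) as [HF | HF].
    - destruct (stage_exists G t F HG HF) as [s Hs]; now exists s.
    - exists (0, 0%Z, []); intros H; contradiction. }
  set (next := fun t F => proj1_sig (constructive_indefinite_description _ (Hstep t F))).
  assert (Hnext : forall t F, (forall f, In f F -> G f) -> stage G t F (next t F)).
  { intros t F; exact (proj2_sig (constructive_indefinite_description _ (Hstep t F))). }
  set (F := nat_rect (fun _ => list R) [alpha 0%nat]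
    (fun t Ft => alpha (S t) :: snd (next t Ft) ++ Ft)).
  assert (Halpha : forall t, G (alpha t)) by (intros t; exists t, 0%Z; ring).
  assert (HF : forall t f, In f (F t) -> G f).
  { induction t as [ | t IH].
    - intros f [<- | []]; apply Halpha.
    - intros f [<- | Hf]; [apply Halpha | ].
      apply in_app_or in Hf; destruct Hf as [Hf | Hf]; [ | now apply IH].
      pose proof (Hnext t (F t) IH) as Hs; unfold stage in Hs; fold (F t) in Hf.
      destruct (next t (F t)) as [[e L] D]; now apply Hs. }
  set (L := fun t => snd (fst (next t (F t)))).
  assert (HL : forall t, (0 < L t)%Z).
  { intros t; pose proof (Hnext t (F t) (HF t)) as Hs; unfold L, stage in *.
    destruct (next t (F t)) as [[e l] D]; apply Hs. }
  (* The term [L t] gives [eta t * L t <= 1/4], as the no-jump argument needs; the term [t] forces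
     [eta] to 0. *)
  set (eta := fun t => / (4 * (IZR (L t) + INR t))).
  assert (HLt : forall t, 1 <= IZR (L t) + INR t).
  { intros t; pose proof (pos_INR t).
    assert (1 <= IZR (L t)) by (apply IZR_le; specialize (HL t); lia); lra. }
  assert (HA : forall t, exists A, separates t (F t) (F (S t)) (eta t) (eta (S t)) A).
  { intros t; pose proof (Hnext t (F t) (HF t)) as Hs.
    assert (HD : forall d, In d (snd (next t (F t))) -> In d (F (S t))).
    { intros d Hd; right; apply in_or_app; now left. }
    pose proof (HL t) as HLt0; unfold L in HLt0.
    assert (Heta : eta t * IZR (L t) <= 1 / 4).
    { unfold eta; pose proof (HLt t); pose proof (pos_INR t).
      apply (Rmult_le_reg_l (4 * (IZR (L t) + INR t))); [lra | ].
      rewrite <- Rmult_assoc, Rinv_r by lra; lra. }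
    unfold L in Heta.
    assert (Heta' : 0 < eta (S t) <= 1 / 2).
    { unfold eta; pose proof (HLt (S t)); split; [apply Rinv_0_lt_compat; lra | ].
      apply (Rmult_le_reg_l (4 * (IZR (L (S t)) + INR (S t)))); [lra | ].
      rewrite Rinv_r by lra; lra. }
    unfold stage in Hs; destruct (next t (F t)) as [[e l] D]; cbn [fst snd] in *.
    destruct Hs as (He & _ & Hsyn & _ & Hdual & Hkill).
    destruct (Hdual (eta (S t)) Heta') as [N1 HN1].
    set (M := (L (S t) + Z.of_nat (S t))%Z).
    (* Long enough for the duality bound [N1] and for a Bohr element [n] in [[M, M + l)]. For it
       [|n gamma| <= 1/8], hence [|gamma| <= 1 / (4 M) = eta (S t)]. *)
    set (N := (N1 + Z.to_nat (l + M))%nat).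
    destruct (Hkill N) as [A (HA0 & HA1 & HA2 & HA3)].
    exists A; split; [exact HA0 | split; [exact HA1 | split; [exact HA2 | ]]].
    intros beta Hb; specialize (HA3 beta Hb); split.
    - destruct (HN1 beta) as [d [Hd Hdn]].
      + intros n Hn Hbn; apply (near_weaken (1 / 12)); [lra | apply HA3; [lia | exact Hbn]].
      + exists d; split; [now apply HD | exact Hdn].
    - intros d gamma z Hd Hbg Hg.
      assert (HM : (0 < M)%Z) by (unfold M; specialize (HL (S t)); lia).
      assert (Hsmall : forall n, (0 <= n <= Z.of_nat N)%Z -> bohr (F t) e n ->
        Rabs (IZR n * gamma) <= 1 / 8).
      { apply (syndetic_multiples_small _ l); [exact Hsyn | | ].
        - intros n Hn Hbn.
          replace (IZR n * gamma) with (IZR n * beta - IZR n * d + IZR (- (n * z)))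
            by (rewrite opp_IZR, mult_IZR, Hbg; ring).
          (* Here [e <= 1/64] is used: [1/12 + 1/64 <= 1/8]. *)
          apply near_add_Z, (near_weaken (1 / 12 + e)); [lra | ].
          apply near_sub; [now apply HA3 | now apply Hbn].
        - apply IZR_lt in HLt0; nra. }
      destruct (Hsyn M) as [n [Hn Hbn]].
      specialize (Hsmall n ltac:(unfold N; lia) Hbn).
      rewrite Rabs_mult in Hsmall.
      assert (HMn : IZR M <= IZR n) by (apply IZR_le; lia).
      assert (HM0 : 1 <= IZR M) by (apply IZR_le; lia).
      rewrite Rabs_right in Hsmall by lra.
      replace (eta (S t)) with (/ (4 * IZR M))
        by (unfold eta, M; rewrite plus_IZR, (INR_IZR_INZ (S t)); reflexivity).
      apply (Rmult_le_reg_l (4 * IZR M)); [lra | rewrite Rinv_r by lra].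
      pose proof (Rabs_pos gamma); nra. }
  exists F, eta, (fun t => proj1_sig (constructive_indefinite_description _ (HA t))).
  split; [exact HF | split; [ | split; [ | split]]].
  - intros [ | t]; now left.
  - intros t f Hf; right; apply in_or_app; now right.
  - intros t; unfold eta; apply Rinv_le_contravar; [apply lt_0_INR; lia | ].
    assert (0 < IZR (L (S t))) by (apply IZR_lt, HL).
    pose proof (pos_INR (S t)); lra.
  - intros t; exact (proj2_sig (constructive_indefinite_description _ (HA t))).
Qed.

Lemma increasing_enumeration (P : nat -> Prop) : (forall m, exists n, (m < n)%nat /\ P n) ->
  exists a : nat -> nat, (0 < a 0)%nat /\ (forall k, (a k < a (S k))%nat) /\
    (forall k, P (a k)) /\ forall n, (0 < n)%nat -> P n -> exists k, a k = n.
Proof.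
  intros HP.
  assert (Hleast : forall m, exists n, ((m < n)%nat /\ P n) /\
    forall n', (m < n')%nat /\ P n' -> (n <= n')%nat).
  { intros m.
    destruct (dec_inh_nat_subset_has_unique_least_element (fun n => (m < n)%nat /\ P n))
      as [n [Hn _]]; [intros n; apply classic | apply HP | now exists n]. }
  set (next := fun m => proj1_sig (constructive_indefinite_description _ (Hleast m))).
  assert (Hnext : forall m, ((m < next m)%nat /\ P (next m)) /\
    forall n', (m < n')%nat /\ P n' -> (next m <= n')%nat).
  { intros m; exact (proj2_sig (constructive_indefinite_description _ (Hleast m))). }
  set (a := nat_rect (fun _ => nat) (next 0%nat) (fun _ m => next m)).
  assert (Hinc : forall k, (a k < a (S k))%nat) by (intros k; apply (Hnext (a k))).
  exists a; split; [apply (Hnext 0%nat) | split; [exact Hinc | split]].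
  - intros [ | k]; apply Hnext.
  - intros n Hn HPn.
    assert (Hk : forall k, (n <= a k)%nat -> exists j, a j = n).
    { induction k as [ | k IH]; intros Hle.
      - exists 0%nat; apply Nat.le_antisymm; [now apply (Hnext 0%nat) | exact Hle].
      - destruct (le_lt_dec n (a k)) as [H | H]; [now apply IH | ].
        exists (S k); apply Nat.le_antisymm; [now apply (Hnext (a k)) | exact Hle]. }
    apply (Hk n); clear - Hinc; induction n as [ | n IH]; [lia | specialize (Hinc n); lia].
Qed.

(** Only [l] must be free of repetitions: the sets of different stages may overlap, and their
    concatenation then counts a value several times. *)
Lemma sum_over_incl (u : nat -> R) (l l' : list nat) :
  (forall n, 0 <= u n) -> NoDup l -> incl l l' -> sum_over u l <= sum_over u l'.
Proof.
  intros Hu; revert l'; induction l as [ | x l IH]; intros l' Hnd Hincl.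
  - simpl; induction l' as [ | y l' IH']; simpl; [lra | ].
    assert (0 <= sum_over u l') by (apply IH'; intros z []); specialize (Hu y); lra.
  - inversion Hnd as [ | ? ? Hx Hnd']; subst.
    destruct (in_split x l' (Hincl x (or_introl eq_refl))) as [l1 [l2 ->]].
    rewrite sum_over_app; simpl.
    assert (H : sum_over u l <= sum_over u (l1 ++ l2)).
    { apply IH; [exact Hnd' | intros y Hy].
      assert (Hy' := Hincl y (or_intror Hy)).
      apply in_app_or in Hy'; apply in_or_app.
      destruct Hy' as [Hy' | [-> | Hy']]; [now left | contradiction | now right]. }
    rewrite sum_over_app in H; lra.
Qed.

Lemma psum_nonneg (u : nat -> R) (n : nat) : (forall i, 0 <= u i) -> 0 <= psum u n.
Proof.
  intros Hu; induction n as [ | n IH]; [unfold psum; simpl; lra | ].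
  rewrite psum_S; specialize (Hu n); lra.
Qed.

Lemma psum_eventually_geometric (u : nat -> R) (t1 n : nat) :
  (forall i, 0 <= u i) -> (forall t, (t1 <= t)%nat -> u t <= (1 / 2) ^ t) ->
  psum u n <= psum u t1 + 2.
Proof.
  intros Hu Ht.
  apply Rle_trans with (psum u (t1 + n)).
  - rewrite Nat.add_comm, psum_add.
    pose proof (psum_nonneg (fun i => u (n + i)%nat) t1 (fun i => Hu (n + i)%nat)); lra.
  - rewrite psum_add; apply Rplus_le_compat_l.
    enough (psum (fun i => u (t1 + i)%nat) n <= 2 - 2 * (1 / 2) ^ n)
      by (assert (0 < (1 / 2) ^ n) by (apply pow_lt; lra); lra).
    induction n as [ | n IH]; [unfold psum; simpl; lra | ].
    rewrite psum_S; specialize (Ht (t1 + n)%nat ltac:(lia)).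
    assert ((1 / 2) ^ (t1 + n) <= (1 / 2) ^ n).
    { rewrite pow_add; assert ((1 / 2) ^ t1 <= 1) by (apply pow_le_one; lra).
      assert (0 < (1 / 2) ^ n) by (apply pow_lt; lra); nra. }
    simpl pow; lra.
Qed.

Lemma psum_flat_map (u : nat -> R) (A : nat -> list nat) (n : nat) :
  sum_over u (flat_map A (seq 0 n)) = psum (fun t => sum_over u (A t)) n.
Proof.
  induction n as [ | n IH]; [reflexivity | ].
  rewrite psum_S, seq_S, flat_map_app, sum_over_app, IH; simpl; now rewrite app_nil_r.
Qed.

Lemma strict_mono (a : nat -> nat) :
  (forall k, (a k < a (S k))%nat) -> forall i j, (i < j)%nat -> (a i < a j)%nat.
Proof. intros Ha i j Hij; induction Hij as [ | j _ IH]; [ | specialize (Ha j)]; auto; lia. Qed.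

(** Partial sums increase and are bounded: the stages before [t1] contribute a fixed finite amount,
    the later ones at most a geometric series. *)
Lemma ex_series_enumeration (a : nat -> nat) (A : nat -> list nat) (u : nat -> R) (t1 : nat) :
  (forall k, (a k < a (S k))%nat) -> (forall k, exists t, In (a k) (A t)) ->
  (forall t n, In n (A t) -> (t < n)%nat) -> (forall n, 0 <= u n) ->
  (forall t, (t1 <= t)%nat -> sum_over u (A t) <= (1 / 2) ^ t) ->
  ex_series (fun k => u (a k)).
Proof.
  intros Hinc HaA HAt Hu Hgeo.
  set (v := fun k => u (a k)).
  assert (Hv : forall K, sum_n v K = sum_over u (map a (seq 0 (S K)))).
  { induction K as [ | K IH].
    - rewrite sum_O; unfold v; simpl; ring.
    - rewrite sum_Sn, IH, (seq_S (S K)), map_app, sum_over_app; unfold plus, v; simpl; ring. }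
  destruct (ex_finite_lim_seq_incr (sum_n v)
    (psum (fun t => sum_over u (A t)) t1 + 2)) as [l Hl].
  - intros K; rewrite sum_Sn; unfold plus; simpl; specialize (Hu (a (S K))); unfold v; lra.
  - intros K; rewrite Hv.
    apply Rle_trans with (sum_over u (flat_map A (seq 0 (S (a K))))).
    + apply sum_over_incl; [exact Hu | | ].
      * apply FinFun.Injective_map_NoDup; [ | apply seq_NoDup].
        intros i j Hij; destruct (Nat.lt_total i j) as [H | [H | H]]; [ | exact H | ];
          apply (strict_mono a Hinc) in H; lia.
      * intros n Hn; apply in_map_iff in Hn; destruct Hn as [k [<- Hk]]; apply in_seq in Hk.
        destruct (HaA k) as [t Ht]; apply in_flat_map; exists t; split; [ | exact Ht].
        apply in_seq; specialize (HAt t (a k) Ht).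
        assert (a k <= a K)%nat.
        { destruct (Nat.eq_dec k K) as [-> | Hne]; [lia | ].
          pose proof (strict_mono a Hinc k K ltac:(lia)); lia. }
        lia.
    + rewrite psum_flat_map; apply psum_eventually_geometric; [ | exact Hgeo].
      intros t; apply (sum_over_incl u [] (A t) Hu (NoDup_nil _)); intros n [].
  - exists l; exact Hl.
Qed.

Lemma LimSup_seq_lt_eventually (u : nat -> R) (c : R) :
  ~ Rbar_le c (LimSup_seq u) -> exists N, forall n, (N <= n)%nat -> u n < c.
Proof.
  intros H; unfold LimSup_seq in H; destruct (ex_LimSup_seq u) as [l Hl]; simpl in H.
  destruct l as [l | | ]; simpl in H, Hl.
  - assert (Hlc : l < c) by lra.
    destruct (Hl (mkposreal (c - l) ltac:(lra))) as [_ [N HN]]; simpl in HN.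
    exists N; intros n Hn; specialize (HN n Hn); lra.
  - tauto.
  - exact (Hl c).
Qed.

Theorem theorem1 (alpha : nat -> R) (HG : is_subgroup_T alpha) :
  exists a : nat -> nat,
    (0 < a 0)%nat /\ (forall k, (a k < a (S k))%nat) /\
    forall beta : R,
      (inG alpha beta ->
         forall r : R, 0 < r ->
           ex_series (fun k => rpow (dist_Z (INR (a k) * beta)) r)) /\
      (~ inG alpha beta ->
         Rbar_le (Finite (1/6)) (LimSup_seq (fun k => dist_Z (INR (a k) * beta)))).
Proof.
  destruct (separating_sets alpha HG) as (F & eta & A & HFG & HFa & HFS & Heta & HA).
  destruct (increasing_enumeration (fun n => exists t, In n (A t)))
    as (a & Ha0 & Hinc & HaA & Hsurj).
  { intros m; destruct (HA m) as (Hne & Hlt & _).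
    destruct (A m) as [ | n l] eqn:E; [contradiction | ].
    exists n; split; [apply Hlt; now left | exists m; rewrite E; now left]. }
  exists a; split; [exact Ha0 | split; [exact Hinc | ]].
  assert (Hmono : forall s t f, (s <= t)%nat -> In f (F s) -> In f (F t)).
  { intros s t f Hst Hf; induction Hst as [ | t _ IH]; auto. }
  intros beta; split.
  - intros [i [z ->]] r Hr.
    destruct (INR_unbounded (/ r)) as [T HT].
    (* From stage [i] on, [alpha i] belongs to [F t]; from stage [T] on, [r] is at least
       [1 / (t + 1)]. *)
    apply (ex_series_enumeration a A
      (fun n => rpow (dist_Z (INR n * (alpha i + IZR z))) r) (Nat.max i T)); auto.
    + intros t n Hn; now apply (HA t).
    + intros n; apply rpow_ge0.
    + intros t Ht; destruct (HA t) as (_ & _ & Hsum & _).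
      assert (Hf : In (alpha i) (F t)) by (apply (Hmono i); [lia | apply HFa]).
      assert (Hrt : / INR (S t) <= r).
      { rewrite <- (Rinv_inv r); apply Rinv_le_contravar; [now apply Rinv_0_lt_compat | ].
        apply Rle_trans with (INR T); [lra | apply le_INR; lia]. }
      specialize (Hsum (alpha i) Hf r Hrt).
      eapply Rle_trans; [ | exact Hsum]; right.
      clear Hsum; induction (A t) as [ | n l IH]; [reflexivity | simpl; rewrite IH].
      replace (INR n * (alpha i + IZR z)) with (INR n * alpha i + IZR (Z.of_nat n * z))
        by (rewrite mult_IZR, <- INR_IZR_INZ; ring).
      now rewrite dist_Z_add_Z.
  - intros Hbeta; apply NNPP; intros Hlim; apply Hbeta.
    apply LimSup_seq_lt_eventually in Hlim; destruct Hlim as [K HK].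
    (* Elements of [A t] with [t >= a K] exceed [a K], so their indices in [a] are beyond [K] and
       [beta] survives all these stages. *)
    set (t0 := a K).
    assert (Hsurv : forall t, (t0 <= t)%nat ->
      forall n, In n (A t) -> dist_Z (INR n * beta) < 1 / 6).
    { intros t Ht n Hn; assert (Htn : (t < n)%nat) by now apply (HA t).
      destruct (Hsurj n ltac:(lia) (ex_intro _ t Hn)) as [k <-].
      apply HK; destruct (le_lt_dec K k) as [H | H]; [exact H | ].
      apply (strict_mono a Hinc) in H; unfold t0 in Ht; lia. }
    destruct (HA t0) as (_ & _ & _ & Hsep).
    destruct (Hsep beta (Hsurv t0 (le_n _))) as [[d [Hd [z Hz]]] _].
    (* The stage [t0] fixes [d], [z] and [gamma] once and for all; each later stage only improves
       the bound on this same [gamma]. *)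
    set (gamma := beta - d - IZR z) in *.
    assert (Hg : forall i, Rabs gamma <= eta (S t0 + i)%nat).
    { induction i as [ | i IH]; [now rewrite Nat.add_0_r | ].
      destruct (HA (S t0 + i)%nat) as (_ & _ & _ & Hsep').
      destruct (Hsep' beta (Hsurv (S t0 + i)%nat ltac:(lia))) as [_ Hshrink].
      rewrite Nat.add_succ_r; apply (Hshrink d gamma z).
      - apply (Hmono (S t0)); [lia | exact Hd].
      - unfold gamma; ring.
      - exact IH. }
    assert (Hg0 : gamma = 0).
    { apply NNPP; intros Hne; apply Rabs_pos_lt in Hne.
      destruct (INR_unbounded (/ Rabs gamma)) as [i Hi].
      specialize (Hg i); specialize (Heta (t0 + i)%nat).
      assert (Hlt : / INR (S (t0 + i)) < Rabs gamma).
      { rewrite <- (Rinv_inv (Rabs gamma)); apply Rinv_lt_contravar.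
        - apply Rmult_lt_0_compat; [now apply Rinv_0_lt_compat | apply lt_0_INR; lia].
        - apply Rlt_le_trans with (INR i); [exact Hi | apply le_INR; lia]. }
      simpl Nat.add in Hg; lra. }
    destruct (HFG (S t0) d Hd) as [t [y ->]].
    exists t, (y + z)%Z; rewrite plus_IZR; unfold gamma in Hg0; lra.
Qed.
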